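(* Let $\mu$ be a stationary, ergodic cocycle measure on $\mathbb{Z}^2$ with $0<h,v<1$. If infinite clusters exist with positive $\mu$-probability (and hence, by ergodicity, with $\mu$-probability one), then there are infinitely many infinite clusters $\mu$-a.s.
   Context: Label the nearest-neighbour edges of $\mathbb{Z}^2$ with $0$ or $1$; configurations live in $\{0,1\}^E$, $E$ being the edge set, with the product $\sigma$-field. For a vertex-self-avoiding path $\pi$ from $x$ to $y$, let $\pi^+$ be the set of its edges travelled to the right or upwards, and $\pi^-$ the set of its edges travelled to the left or downwards. A configuration has the cocycle property if for all vertices $x,y$ both (number of edges labelled $1$ in $\pi^+$ minus number labelled $1$ in $\pi^-$) and (number of edges labelled $0$ in $\pi^+$ minus number labelled $0$ in $\pi^-$) are the same for all such paths $\pi$ from $x$ to $y$. Equivalently, on every unit square: label(bottom) + label(right) = label(left) + label(top). A cocycle measure is a probability measure $\mu$ on $\{0,1\}^E$ concentrated on configurations with the cocycle property. Stationary means invariant under all translations of $\mathbb{Z}^2$; ergodic means ergodic with respect to the group of all translations of $\mathbb{Z}^2$. $h$ and $v$ are the expectations under $\mu$ of the label of a horizontal, respectively vertical, edge; it is assumed that $0<h,v<1$. The cluster $C(z)$ of a vertex $z$ is the set of vertices that can be reached from $z$ by travelling over edges labelled $0$ only. *)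

(* Defs.v *)
From HB Require Import structures.
From mathcomp Require Export all_boot all_order all_algebra.
From mathcomp Require Export all_classical all_reals all_analysis.

Set Implicit Arguments.
Unset Strict Implicit.
Unset Printing Implicit Defensive.

Import Order.TTheory GRing.Theory Num.Theory.

Local Open Scope classical_set_scope.
Local Open Scope ring_scope.

Notation vertex := (int * int)%type.

Definition horizontal : bool := false.
Definition vertical : bool := true.

Definition unit_vec (d : bool) : vertex :=
  if d == horizontal then (1, 0) else (0, 1).

(* The edge (z, d) joins z to z + unit_vec d, i.e., z is its left (resp.
   bottom) endpoint. *)
Notation edge := (vertex * bool)%type.

(* A label is a boolean: true for 1, false for 0.  As bool carries the discrete
   sigma-algebra, the following sets generate the product sigma-algebra on
   {0,1}^E. *)
Definition coordinate_events : set (set (edge -> bool)) :=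
  \bigcup_(e in [set: edge])
    preimage_set_system setT (fun w : edge -> bool => w e) measurable.

Notation config := (g_sigma_algebraType coordinate_events).

(* The edge travelled rightwards or upwards by the step from u to v: a list
   with one element if there is such an edge, and the empty list otherwise. *)
Definition forward_edge (u v : vertex) : seq edge :=
  [seq (u, d) | d <- [:: horizontal; vertical] & v == u + unit_vec d].

Definition edges_between (u v : vertex) : seq edge :=
  forward_edge u v ++ forward_edge v u.

Definition adjacent : rel vertex := fun u v => edges_between u v != [::].

(* As in path.v, a path is given by its starting point x and the list p of the
   vertices that follow x. *)
Definition self_avoiding_path (x y : vertex) (p : seq vertex) : bool :=
  [&& path adjacent x p, last x p == y & uniq (x :: p)].

(* pi^+ and pi^-, as lists; for a self-avoiding path they have no repetition. *)
Definition positive_edges (x : vertex) (p : seq vertex) : seq edge :=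
  flatten [seq forward_edge s.1 s.2 | s <- zip (x :: p) p].

Definition negative_edges (x : vertex) (p : seq vertex) : seq edge :=
  flatten [seq forward_edge s.2 s.1 | s <- zip (x :: p) p].

Definition signed_count (w : config) (l : bool) (x : vertex) (p : seq vertex)
    : int :=
  (count (fun e => w e == l) (positive_edges x p))%:Z
  - (count (fun e => w e == l) (negative_edges x p))%:Z.

Definition cocycle (w : config) : Prop :=
  forall (x y : vertex) (p q : seq vertex),
    self_avoiding_path x y p -> self_avoiding_path x y q ->
    forall l : bool, signed_count w l x p = signed_count w l x q.

Definition cocycle_measure (R : realType) (mu : probability config R) : Prop :=
  {ae mu, forall w, cocycle w}.

Definition translate (a : vertex) (w : config) : config :=
  fun e => w (e.1 + a, e.2).

Definition stationary (R : realType) (mu : probability config R) : Prop :=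
  forall (a : vertex) (A : set config), measurable A ->
    mu (translate a @^-1` A) = mu A.

Definition ergodic (R : realType) (mu : probability config R) : Prop :=
  forall A : set config, measurable A ->
    (forall a : vertex, translate a @^-1` A = A) ->
    mu A = 0%E \/ mu A = 1%E.

(* Expected labels of a horizontal and of a vertical edge; for a stationary
   measure they do not depend on the choice of the edge. *)
Definition mean_h (R : realType) (mu : probability config R) : \bar R :=
  expectation mu (fun w : config => (w (0, horizontal))%:R).

Definition mean_v (R : realType) (mu : probability config R) : \bar R :=
  expectation mu (fun w : config => (w (0, vertical))%:R).

Definition zero_adjacent (w : config) : rel vertex :=
  fun u v => has (fun e => w e == false) (edges_between u v).

Definition cluster (w : config) (z : vertex) : set vertex :=
  [set y | exists2 p : seq vertex, path (zero_adjacent w) z p & last z p = y].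

Definition infinite_clusters (w : config) : set (set vertex) :=
  [set C | infinite_set C /\ exists z : vertex, C = cluster w z].

(* Main.v *)
Require Import Defs.
From mathcomp Require Import measurable_realfun zify lra ring.
Import Order.TTheory GRing.Theory Num.Theory.

(* A configuration with the cocycle property is the discrete gradient of a
   height function f, normalised by f(0) = 0, and f is constant on clusters.
   Suppose that almost surely the number of infinite clusters is finite and
   positive.  Then their heights are bounded by a random M; choose a constant M
   that works with probability close to 1.  Translating the configuration by a
   shifts heights by -f(a), so if M works both for w and for its translate by
   a = (n, 0), then f(n, 0) <= 2M.  As 0 <= f(n, 0) <= n, this yields
   n h = E f(n, 0) <= 2M + n eps with eps as small as we like, which is absurd
   for large n since h > 0. *)

Set Implicit Arguments.
Unset Strict Implicit.
Unset Printing Implicit Defensive.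

Local Open Scope classical_set_scope.
Local Open Scope ring_scope.

(** * Discrete antiderivatives and step-invariant functions *)

(** The discrete antiderivative of [g] that vanishes at [0]: the sign and the shift on negative
    arguments are those for which [int_sumS] holds on all integers. *)
Definition int_sum (g : int -> int) (x : int) : int :=
  match x with
  | Posz n => \sum_(i < n) g i
  | Negz n => - \sum_(i < n.+1) g (Negz i)
  end.

Lemma int_sumS (g : int -> int) (x : int) :
  int_sum g (x + 1) = int_sum g x + g x.
Proof.
case: x => [n|[|n]].
- by rewrite -PoszD addn1 /= big_ord_recr.
- by rewrite /= big_ord_recl !big_ord0 addr0 addNr.
- have -> : Negz n.+1 + 1 = Negz n by rewrite !NegzE; lia.
  by rewrite /= [in RHS]big_ord_recr /= opprD addrNK.
Qed.

Lemma int_invariant_const (T : Type) (g : int -> T) :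
  (forall x, g (x + 1) = g x) -> forall x, g x = g 0.
Proof.
move=> gS; elim/int_ind => [//|n IH|n IH]; first by rewrite -addn1 PoszD gS.
by rewrite -IH -(gS (- n.+1%:Z)); congr g; lia.
Qed.

Lemma add_unit_horizontal (x y : int) :
  (x, y) + unit_vec horizontal = (x + 1, y) :> vertex.
Proof. by congr pair; rewrite /= addr0. Qed.

Lemma add_unit_vertical (x y : int) :
  (x, y) + unit_vec vertical = (x, y + 1) :> vertex.
Proof. by congr pair; rewrite /= addr0. Qed.

Lemma vertex_invariant_const (T : Type) (g : vertex -> T) :
  (forall z d, g (z + unit_vec d) = g z) -> forall z, g z = g 0.
Proof.
move=> gS [x y].
transitivity (g (x, 0)).
  apply: (int_invariant_const (g := fun j => g (x, j))) => j.
  by rewrite -add_unit_vertical gS.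
apply: (int_invariant_const (g := fun i => g (i, 0))) => i.
by rewrite -add_unit_horizontal gS.
Qed.

(** * The height function of a configuration *)

(** Labels are summed along one fixed route from the origin, first on the horizontal axis and then
    vertically; vertical increments are then immediate, and only horizontal ones need the square
    law. *)
Definition height (w : config) (z : vertex) : int :=
  int_sum (fun i => w ((i, 0), horizontal)) z.1
  + int_sum (fun j => w ((z.1, j), vertical)) z.2.

Lemma eq_addl (u a b v : vertex) : v = u + a -> (v == u + b) = (a == b).
Proof. by move=> ->; exact: (inj_eq (addrI u)). Qed.

Lemma eq_addr (u a b v : vertex) : v = a + u -> (v == b + u) = (a == b).
Proof. by move=> ->; exact: (inj_eq (addIr u)). Qed.

Lemma forward_edge_step (u : vertex) (d : bool) :
  forward_edge u (u + unit_vec d) = [:: (u, d)].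
Proof. by rewrite /forward_edge /= !(eq_addl _ (erefl (_ + _))); case: d. Qed.

Lemma backward_edge_step (u : vertex) (d : bool) :
  forward_edge (u + unit_vec d) u = [::].
Proof.
rewrite /forward_edge /= -!addrA !(eq_addl _ (esym (addr0 u))).
by case: d.
Qed.

Definition square_law (w : config) : Prop := forall z : vertex,
  (w (z, horizontal) : int) + w (z + unit_vec horizontal, vertical)
  = (w (z, vertical) : int) + w (z + unit_vec vertical, horizontal) :> int.

(** Compare the label-1 counts of the two monotone paths from [z] to [z + (1, 1)]; they travel no
    edge backwards, so signed counts are plain sums. *)
Lemma cocycle_square_law (w : config) : cocycle w -> square_law w.
Proof.
move=> cw z; move: cw.
pose corner d := [:: z + unit_vec d; z + unit_vec d + unit_vec (~~ d)].
have cornerP d : self_avoiding_path z (z + (1, 1)) (corner d).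
  apply/and3P; split => /=.
  - by rewrite /adjacent /edges_between !forward_edge_step.
  - by rewrite -addrA (eq_addl _ (erefl (_ + _))); case: d.
  - rewrite !inE -!addrA !(eq_addl _ (esym (addr0 z))).
    by rewrite (eq_addl _ (erefl (_ + _))); case: d.
have cornerE w' d : signed_count w' true z (corner d)
    = (w' (z, d) : int) + w' (z + unit_vec d, ~~ d).
  rewrite /signed_count /positive_edges /negative_edges /=.
  rewrite !forward_edge_step !backward_edge_step /= subr0 addn0.
  by rewrite PoszD !eqb_id.
by move=> /(_ _ _ _ _ (cornerP horizontal) (cornerP vertical) true);
  rewrite !cornerE.
Qed.

(** A vertical step merely lengthens the route. For a horizontal step, the defect [D j] in row [j]
    does not depend on [j] by the square law, and it vanishes on the axis. *)
Lemma height_step (w : config) (z : vertex) (d : bool) : square_law w ->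
  height w (z + unit_vec d) = height w z + w (z, d).
Proof.
move=> cw; case: z => x y; case: d.
  by rewrite (add_unit_vertical x y) /height /= int_sumS addrA.
rewrite (add_unit_horizontal x y) /height /= int_sumS.
(* The cast on the last label matters: otherwise the minus sign is parsed as
   the opposite in the ring bool. *)
pose D j : int := int_sum (fun j => w ((x + 1, j), vertical)) j
  + w ((x, 0), horizontal)
  - int_sum (fun j => w ((x, j), vertical)) j - (w ((x, j), horizontal) : int).
have /(_ y) : forall j, D j = D 0.
  apply: int_invariant_const => j; rewrite /D !int_sumS.
  have := cw (x, j).
  rewrite (add_unit_horizontal x j) (add_unit_vertical x j).
  by move: (Posz _) (Posz _) (Posz _) (Posz _) (Posz _) => *; lia.
rewrite /D /= !big_ord0; move: (Posz _) (Posz _) => *; lia.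
Qed.

Lemma height0 (w : config) : height w 0 = 0.
Proof. by rewrite /height /= !big_ord0. Qed.

(** As functions of [z], both sides vanish at [0] and have the labels of [translate a w] as
    increments, so their difference is constant. *)
Lemma height_translate (w : config) (a z : vertex) :
  square_law w -> square_law (translate a w) ->
  height (translate a w) z = height w (z + a) - height w a.
Proof.
move=> cw caw; apply/eqP; rewrite -subr_eq0 opprB addrA; apply/eqP.
pose g z : int := height (translate a w) z + height w a - height w (z + a).
have /vertex_invariant_const/(_ z) : forall z d, g (z + unit_vec d) = g z.
  move=> y d; rewrite /g height_step// (addrAC y) height_step//.
  by rewrite [translate a w (y, d)]/translate /=; ring.
by rewrite /g height0 !add0r subrr.
Qed.

(** * Clusters: constant height and translations *)

Lemma zero_adjacent_height (w : config) (u v : vertex) :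
  square_law w -> zero_adjacent w u v -> height w u = height w v.
Proof.
move=> cw /hasP[e]; rewrite mem_cat => /orP[] /mapP[d];
  rewrite mem_filter => /andP[/eqP-> _] -> /eqP we0;
  by rewrite height_step// we0 addr0.
Qed.

Lemma cluster_height (w : config) (z y : vertex) :
  square_law w -> cluster w z y -> height w y = height w z.
Proof.
move=> cw [p + <-]; elim: p z => //= v p IH z /andP[zv /IH->].
exact/esym/zero_adjacent_height.
Qed.

Lemma forward_edge_translate (a u v : vertex) :
  forward_edge (u + a) (v + a) = [seq (e.1 + a, e.2) | e <- forward_edge u v].
Proof.
rewrite /forward_edge -map_comp.
under eq_filter => d do rewrite addrAC (eq_addr _ (erefl (_ + _))).
by apply: eq_map.
Qed.

Lemma zero_adjacent_translate (w : config) (a u v : vertex) :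
  zero_adjacent (translate a w) u v = zero_adjacent w (u + a) (v + a).
Proof.
by rewrite /zero_adjacent /edges_between !forward_edge_translate -map_cat has_map.
Qed.

Lemma cluster_translate (w : config) (a z y : vertex) :
  cluster (translate a w) z y <-> cluster w (z + a) (y + a).
Proof.
have Hp p x : path (zero_adjacent (translate a w)) x p
    = path (zero_adjacent w) (x + a) [seq v + a | v <- p].
  by elim: p x => //= v p IH x; rewrite IH zero_adjacent_translate.
split => [[p hp <-]|[p hp hy]].
  exists [seq v + a | v <- p]; first by rewrite -Hp.
  exact: (last_map (fun v => v + a)).
exists [seq v - a | v <- p].
  by rewrite Hp -map_comp map_id_in// => v _ /=; rewrite subrK.
have -> : z = z + a - a by rewrite addrK.
by rewrite [LHS](last_map (fun v => v - a)) hy addrK.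
Qed.

Lemma cluster_refl (w : config) (z : vertex) : cluster w z z.
Proof. by exists [::]. Qed.

(** Over a countable type this expresses infinitude by countable quantifiers, which gives
    measurability; finite lists are also easy to translate. *)
Lemma infinite_setE (T : choiceType) (A : set T) :
  infinite_set A <-> forall s : seq T, exists2 y, y \notin s & A y.
Proof.
split=> [infA s|H].
  apply: contrapT => nex; apply: infA.
  apply: (sub_finite_set _ (finite_seq s)) => y Ay /=.
  by apply: contrapT => /negP ys; apply: nex; exists y.
by case/finite_seqP => s As; have [y /negP ys] := H s; rewrite As.
Qed.

Lemma infinite_cluster_translate (w : config) (a z : vertex) :
  infinite_set (cluster (translate a w) z) <-> infinite_set (cluster w (z + a)).
Proof.
rewrite !infinite_setE; split => H s.
  have [y ys cy] := H [seq v - a | v <- s].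
  exists (y + a); last exact/cluster_translate.
  by apply: contra ys => ys; apply/mapP; exists (y + a); rewrite ?addrK.
have [y ys cy] := H [seq v + a | v <- s].
exists (y - a); last by apply/cluster_translate; rewrite subrK.
by apply: contra ys => ys; apply/mapP; exists (y - a); rewrite ?subrK.
Qed.

(** * Measurability of events defined through labels *)

(** Measurability for the discrete sigma-algebra on [T], a notion stable under composition with any
    function out of [T]. *)
Definition discrete_measurable (T : Type) (g : config -> T) :=
  forall A : set T, measurable (g @^-1` A).


Lemma discrete_measurable_comp (T U : Type) (h : T -> U) (g : config -> T) :
  discrete_measurable g -> discrete_measurable (fun w => h (g w)).
Proof. by move=> mg A; apply: mg (h @^-1` A). Qed.

(** Split according to the value of [g1], which gives a countable union. *)
Lemma discrete_measurable_comp2 (T1 T2 : countType) (U : Type)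
    (h : T1 -> T2 -> U) (g1 : config -> T1) (g2 : config -> T2) :
  discrete_measurable g1 -> discrete_measurable g2 ->
  discrete_measurable (fun w => h (g1 w) (g2 w)).
Proof.
move=> m1 m2 A.
have -> : (fun w => h (g1 w) (g2 w)) @^-1` A =
    \bigcup_(t1 : T1) (g1 @^-1` [set t1] `&` g2 @^-1` [set t2 | A (h t1 t2)]).
  by apply/seteqP; split => w /=; [exists (g1 w)|case=> t1 _ [/= ->]].
apply: countable_bigcupT_measurable => // t1.
by apply: measurableI; [exact: m1|exact: m2].
Qed.

Lemma discrete_measurable_cst (T : Type) (t : T) :
  discrete_measurable (fun=> t).
Proof.
move=> A; have [At|nAt] := pselect (A t).
  rewrite (_ : _ @^-1` _ = setT); first exact: measurableT.
  by apply/seteqP; split.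
rewrite (_ : _ @^-1` _ = set0); first exact: measurable0.
by apply/seteqP; split.
Qed.

Lemma discrete_measurable_label (e : edge) :
  discrete_measurable (fun w : config => w e).
Proof.
move=> A; apply: sub_sigma_algebra; exists e => //.
by exists A => //; rewrite setTI.
Qed.

Lemma discrete_measurable_sum (n : nat) (g : nat -> config -> int) :
  (forall i, discrete_measurable (g i)) ->
  discrete_measurable (fun w => \sum_(i < n) g i w).
Proof.
move=> mg; elim: n => [|n IH].
  under [X in discrete_measurable X]eq_fun do rewrite big_ord0.
  exact: discrete_measurable_cst.
under [X in discrete_measurable X]eq_fun do rewrite big_ord_recr/=.
exact: (discrete_measurable_comp2 +%R).
Qed.

Lemma discrete_measurable_int_sum (g : config -> int -> int) (x : int) :
  (forall i, discrete_measurable (g^~ i)) ->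
  discrete_measurable (fun w => int_sum (g w) x).
Proof.
move=> mg; case: x => n /=.
  exact: (@discrete_measurable_sum n (fun i w => g w i)).
apply: (discrete_measurable_comp -%R).
exact: (@discrete_measurable_sum n.+1 (fun i w => g w (Negz i))).
Qed.

Lemma discrete_measurable_height (z : vertex) :
  discrete_measurable (fun w : config => height w z).
Proof.
have mlabel e : discrete_measurable (fun w : config => w e : int).
  exact: (discrete_measurable_comp (fun b : bool => b : int)
    (discrete_measurable_label e)).
by apply: (discrete_measurable_comp2 +%R); apply: discrete_measurable_int_sum.
Qed.

Lemma discrete_measurable_has (T : Type) (g : config -> T -> bool) (s : seq T) :
  (forall t, discrete_measurable (g^~ t)) ->
  discrete_measurable (fun w => has (g w) s).
Proof.
move=> mg; elim: s => [|t s IH] /=; first exact: discrete_measurable_cst.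
exact: (discrete_measurable_comp2 orb).
Qed.

Lemma discrete_measurable_path (z : vertex) (p : seq vertex) :
  discrete_measurable (fun w => path (zero_adjacent w) z p).
Proof.
elim: p z => [|v p IH] z /=; first exact: discrete_measurable_cst.
apply: (discrete_measurable_comp2 andb) => //.
apply: discrete_measurable_has => e.
exact: (discrete_measurable_comp (eq_op^~ false) (discrete_measurable_label e)).
Qed.

Lemma countable_exists_measurable (T : countType) (P : config -> T -> Prop) :
  (forall t, measurable [set w | P w t]) ->
  measurable [set w | exists t, P w t].
Proof.
move=> mP; rewrite (_ : [set _ | _] = \bigcup_t [set w | P w t]).
  exact: countable_bigcupT_measurable.
by apply/seteqP; split => w /= [t] => [Pt|_ Pt]; exists t.
Qed.

Lemma countable_forall_measurable (T : countType) (P : config -> T -> Prop) :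
  (forall t, measurable [set w | P w t]) ->
  measurable [set w | forall t, P w t].
Proof.
move=> mP; rewrite -[X in measurable X]setCK; apply: measurableC.
rewrite (_ : ~` [set w | forall t, P w t] = [set w | exists t, ~ P w t]).
  by apply: countable_exists_measurable => t; exact: (measurableC (mP t)).
by apply/seteqP; split => w /= => [/existsNP//|[t nP /(_ t)]].
Qed.

Lemma imply_measurable (P Q : config -> Prop) :
  measurable [set w | P w] -> measurable [set w | Q w] ->
  measurable [set w | P w -> Q w].
Proof.
move=> mP mQ; rewrite (_ : [set _ | _] = ~` [set w | P w] `|` [set w | Q w]).
  by apply: measurableU => //; exact: measurableC.
apply/seteqP; split => w /= => [PQ|[nP /nP//|//]].
by have [/PQ|] := pselect (P w); [right|left].
Qed.

(** Only countably many finite vertex sequences can serve as the connecting path. *)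
Lemma cluster_measurable (z y : vertex) : measurable [set w | cluster w z y].
Proof.
rewrite (_ : [set w | _] =
    [set w | exists p : seq vertex,
      path (zero_adjacent w) z p /\ last z p = y]).
  apply: countable_exists_measurable => p.
  apply: (measurableI [set w | path (zero_adjacent w) z p]
    [set _ | last z p = y]).
    exact: discrete_measurable_path [set b : bool | b].
  exact: (discrete_measurable_cst (last z p)) [set t | t = y].
by apply/seteqP; split => w /= [p]; [exists p|case; exists p].
Qed.

Lemma infinite_cluster_measurable (z : vertex) :
  measurable [set w | infinite_set (cluster w z)].
Proof.
rewrite (_ : [set w | _] =
    [set w | forall s : seq vertex, exists y, y \notin s /\ cluster w z y]).
  apply: countable_forall_measurable => s.
  apply: countable_exists_measurable => y.
  apply: (measurableI [set _ | y \notin s] [set w | cluster w z y]).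
    exact: (discrete_measurable_cst (y \notin s)) [set b : bool | b].
  exact: cluster_measurable.
apply/seteqP; split => w /= => [/infinite_setE H s|H].
  by have [y] := H s; exists y.
by apply/infinite_setE => s; have [y []] := H s; exists y.
Qed.

Lemma square_law_measurable : measurable [set w | square_law w].
Proof.
apply: countable_forall_measurable => z.
have mlabel2 e e' : discrete_measurable (fun w : config => (w e : int) + w e').
  by apply: (discrete_measurable_comp2 (fun b b' : bool => (b : int) + b'));
    exact: discrete_measurable_label.
exact: (discrete_measurable_comp2 (fun m n : int => m = n) (mlabel2 _ _)
  (mlabel2 _ _) [set P | P]).
Qed.

(** * Translation-invariant events about infinite clusters *)

(** Translations form a group, so stability under [- a] yields the reverse inclusion for [a]. *)
Lemma translate_invariant (A : set config) :
  (forall a w, A w -> A (translate a w)) ->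
  forall a, translate a @^-1` A = A.
Proof.
move=> tA a; apply/seteqP; split => w /=; last exact: tA.
move=> /(tA (- a)).
rewrite (_ : translate (- a) (translate a w) = w)//.
by apply/funext => -[z d]; rewrite /translate /= subrK.
Qed.

Definition exists_infinite_cluster : set config :=
  [set w | exists z, infinite_set (cluster w z)].

(** A finite list of vertices meeting every infinite cluster stands for a finite set of clusters:
    such lists are countable in number, so the event is measurable. *)
Definition finitely_many_infinite_clusters : set config :=
  [set w | exists s : seq vertex, forall z, infinite_set (cluster w z) ->
    exists y, y \in s /\ cluster w y z].

Lemma exists_infinite_cluster_measurable : measurable exists_infinite_cluster.
Proof.
by apply: countable_exists_measurable => z; exact: infinite_cluster_measurable.
Qed.

Lemma finitely_many_infinite_clusters_measurable :
  measurable finitely_many_infinite_clusters.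
Proof.
apply: countable_exists_measurable => s.
apply: countable_forall_measurable => z.
apply: imply_measurable; first exact: infinite_cluster_measurable.
apply: countable_exists_measurable => y.
apply: (measurableI [set _ | y \in s] [set w | cluster w y z]).
  exact: (discrete_measurable_cst (y \in s)) [set b : bool | b].
exact: cluster_measurable.
Qed.

Lemma exists_infinite_cluster_translate (a : vertex) (w : config) :
  exists_infinite_cluster w -> exists_infinite_cluster (translate a w).
Proof.
move=> [z Iz]; exists (z - a).
by apply/infinite_cluster_translate; rewrite subrK.
Qed.

Lemma finitely_many_infinite_clusters_translate (a : vertex) (w : config) :
  finitely_many_infinite_clusters w ->
  finitely_many_infinite_clusters (translate a w).
Proof.
move=> [s Hs]; exists [seq y - a | y <- s] => z.
move=> /infinite_cluster_translate /Hs[y [ys yz]].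
exists (y - a); split; first exact: map_f.
by apply/cluster_translate; rewrite subrK.
Qed.

Lemma finite_infinite_clusters (w : config) :
  finite_set (infinite_clusters w) -> finitely_many_infinite_clusters w.
Proof.
move=> /finite_seqP[cs csE].
(* [rep] picks a base vertex of each cluster, with the junk value [0] on sets that are not
   clusters. *)
have /choice[rep repP] : forall C, exists z,
    (exists z, C = cluster w z) -> C = cluster w z.
  move=> C; have [[z Cz]|nC] := pselect (exists z, C = cluster w z).
    by exists z.
  by exists 0.
exists [seq rep C | C <- cs] => z Iz.
exists (rep (cluster w z)); split.
  apply: map_f.
  have : infinite_clusters w (cluster w z) by split => //; exists z.
  by rewrite csE.
rewrite -(repP (cluster w z)); last by exists z.
exact: cluster_refl.
Qed.

(** * Configurations whose infinite clusters have bounded height *)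

(** The square law makes heights meaningful under translation, and the existence of an infinite
    cluster keeps the height bound from being vacuous. *)
Definition bounded_infinite_clusters (M : nat) : set config :=
  [set w | square_law w] `&` exists_infinite_cluster `&`
  [set w | forall z, infinite_set (cluster w z) -> `|height w z| <= M%:Z].

Lemma bounded_infinite_clusters_measurable (M : nat) :
  measurable (bounded_infinite_clusters M).
Proof.
apply: measurableI.
  apply: measurableI; first exact: square_law_measurable.
  exact: exists_infinite_cluster_measurable.
apply: countable_forall_measurable => z.
apply: imply_measurable; first exact: infinite_cluster_measurable.
exact: (discrete_measurable_height z) [set k | `|k| <= M%:Z].
Qed.

Lemma bounded_infinite_clusters_le (M N : nat) : (M <= N)%N ->
  bounded_infinite_clusters M `<=` bounded_infinite_clusters N.
Proof.
move=> MN w [sw Hw]; split => // z /Hw /le_trans; apply.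
by rewrite lez_nat.
Qed.

Lemma bounded_infinite_clusters_cover (w : config) :
  square_law w -> exists_infinite_cluster w ->
  finitely_many_infinite_clusters w ->
  exists M, bounded_infinite_clusters M w.
Proof.
move=> sw Iw [s Hs].
(* The sum over representatives dominates each of their heights, hence the height of every infinite
   cluster. *)
exists (\sum_(y <- s) `|height w y|%N)%N; split => // z /Hs[y [ys yz]].
rewrite (cluster_height sw yz) -abszE lez_nat.
by rewrite (big_rem y ys) leq_addr.
Qed.

(** An infinite cluster of [translate a w] at [z] is one of [w] at [z + a]; its two heights differ
    by [height w a], and each is at most [M] in absolute value. *)
Lemma height_le_of_bounded (M : nat) (w : config) (a : vertex) :
  bounded_infinite_clusters M w ->
  bounded_infinite_clusters M (translate a w) ->
  height w a <= (M + M)%N%:Z.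
Proof.
move=> [[sw _] Hw] [[saw [z Iz]] Haw].
have := Haw z Iz; rewrite height_translate//.
have /Hw : infinite_set (cluster w (z + a)) by apply/infinite_cluster_translate.
by rewrite PoszD; lia.
Qed.

(** * Expected height along the horizontal axis *)

Definition label_event (n : nat) : set config :=
  [set w | w ((n%:Z, 0), horizontal)].

Lemma label_event_measurable (n : nat) : measurable (label_event n).
Proof. exact: (discrete_measurable_label _) [set b : bool | b]. Qed.

(** Puts the height in the form of a number of occurring events, as [measure_sum_le] requires. *)
Lemma height_horizontal (w : config) (n : nat) :
  height w (n%:Z, 0) = (\sum_(0 <= i < n) (w \in label_event i))%N.
Proof.
rewrite /height /= big_ord0 addr0 big_mkord (big_morph Posz PoszD erefl).
apply: eq_bigr => i _; congr Posz.
by congr nat_of_bool; apply/idP/idP => [h|/set_mem//]; apply/mem_set.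
Qed.

Lemma integral_sum_indic d (T : measurableType d) (R : realType)
    (mu : {measure set T -> \bar R}) (I : Type) (s : seq I) (F : I -> set T) :
  (forall i, measurable (F i)) ->
  (\sum_(i <- s) mu (F i) =
   \int[mu]_x ((\sum_(i <- s) (x \in F i))%N%:R)%:E)%E.
Proof.
move=> mF.
transitivity (\int[mu]_x (\sum_(i <- s) (\1_(F i) x)%:E))%E.
  rewrite ge0_integral_sum//=.
  - by apply: eq_bigr => i _; rewrite integral_indic// setIT.
  - by move=> i; apply/measurable_EFinP; exact: measurable_indic.
apply: eq_integral => x _; rewrite sumEFin natr_sum; congr EFin.
Qed.

(** Integrate the pointwise inequality; expectation bounds thus reduce to counting events in the
    naturals. *)
Lemma measure_sum_le d (T : measurableType d) (R : realType)
    (mu : {measure set T -> \bar R}) (I J : Type) (s : seq I) (t : seq J)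
    (F : I -> set T) (G : J -> set T) :
  (forall i, measurable (F i)) -> (forall j, measurable (G j)) ->
  (forall x, \sum_(i <- s) (x \in F i) <= \sum_(j <- t) (x \in G j))%N ->
  (\sum_(i <- s) mu (F i) <= \sum_(j <- t) mu (G j))%E.
Proof.
move=> mF mG FG; rewrite !integral_sum_indic//.
have msum K (u : seq K) (H : K -> set T) : (forall k, measurable (H k)) ->
    measurable_fun setT (fun x => ((\sum_(k <- u) (x \in H k))%N%:R : R)%:E).
  move=> mH; apply/measurable_EFinP.
  under eq_fun do rewrite natr_sum.
  apply: measurable_sum => k.
  by rewrite (_ : (fun x => _) = \1_(H k))//; exact: measurable_indic.
apply: ge0_le_integral => //.
- exact: msum.
- exact: msum.
- by move=> x _; rewrite lee_fin ler_nat.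
Qed.

Lemma stationary_label_event (R : realType) (mu : probability config R)
    (n : nat) :
  stationary mu -> mu (label_event n) = mean_h mu.
Proof.
move=> st.
transitivity (mu (label_event 0)).
  (* By computation, [label_event n] is the preimage of [label_event 0] under the translation by
     [(n, 0)]. *)
  exact: (st (n%:Z, 0) _ (label_event_measurable 0)).
rewrite /mean_h unlock -[label_event 0]setIT.
rewrite -(integral_indic mu measurableT (label_event_measurable 0)).
apply: eq_integral => w _; rewrite indicE; congr (_%:R%:E); congr nat_of_bool.
by apply/idP/idP => [/set_mem//|h]; apply/mem_set.
Qed.

Lemma translate_measurable (a : vertex) (A : set config) :
  measurable A -> measurable (translate a @^-1` A).
Proof.
have mt : measurable_fun setT (translate a).
  apply: (@measurability _ _ config config setT (translate a)
    coordinate_events) => //.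
  move=> _ [_ [e _ [B _ <-]] <-]; rewrite !setTI.
  exact: (discrete_measurable_label (e.1 + a, e.2)) B.
by move=> mA; have := mt measurableT A mA; rewrite setTI.
Qed.

(** Pointwise, the height of [(n, 0)] is at most [2M] if the bound [M] works before and after
    translation by [(n, 0)], and at most [n] otherwise. Integrate; by stationarity both exceptional
    events have the same probability. *)
Lemma height_tight (R : realType) (mu : probability config R) (M n : nat) :
  stationary mu ->
  (n%:R%:E * mean_h mu <= (M + M)%N%:R%:E
    + n%:R%:E * (mu (~` bounded_infinite_clusters M)
                 + mu (~` bounded_infinite_clusters M)))%E.
Proof.
move=> st.
set A := bounded_infinite_clusters M.
have mA : measurable A := bounded_infinite_clusters_measurable M.
pose B := translate (n%:Z, 0) @^-1` A.
have mB : measurable B := translate_measurable (n%:Z, 0) mA.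
(* The right-hand side as a list of events: the sure event [2M] times, and each exceptional event
   [n] times. *)
pose G (j : option bool) :=
  if j is Some b then if b then ~` A else ~` B else setT.
have mG j : measurable (G j).
  by case: j => [[]|];
    [exact: (measurableC mA)|exact: (measurableC mB)|exact: measurableT].
pose t := nseq (M + M) None ++ nseq n (Some true) ++ nseq n (Some false).
have := @measure_sum_le _ _ _ mu _ _ (index_iota 0 n) t _ _
  label_event_measurable mG.
rewrite !big_cat !big_nseq /= probability_setT.
under eq_bigr do rewrite stationary_label_event//.
have iterE k (x : \bar R) : (iter k (adde x) 0 = k%:R%:E * x)%E.
  elim: k => [|k IH]; first by rewrite mul0e.
  by rewrite iterS IH -addn1 natrD EFinD addeC ge0_muleDl ?lee_fin// mul1e.
rewrite big_const_seq count_predT size_iota subn0 ![iter _ _ _]iterE mule1.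
rewrite (_ : mu (~` B) = mu (~` A)); last exact: (st _ _ (measurableC mA)).
rewrite ge0_muleDr//.
(* What remains is the pointwise count: off [A] or off [B], one block of [n] events suffices; on
   both, the sure events do. *)
apply => w.
rewrite !big_cat !big_nseq /= !iter_addn_0 in_setT mul1n !in_setC.
have [wA|wA] := boolP (w \in A); last first.
  rewrite mul1n (leq_trans _ (leq_trans (leq_addr _ n) (leq_addl _ _)))//.
  rewrite -[leqRHS]subn0 -[leqRHS]muln1 -sum_nat_const_nat.
  by apply: leq_sum => i _; case: (_ \in _).
have [wB|wB] := boolP (w \in B); last first.
  rewrite mul1n mul0n (leq_trans _ (leq_addl _ _))//.
  rewrite -[leqRHS]subn0 -[leqRHS]muln1 -sum_nat_const_nat.
  by apply: leq_sum => i _; case: (_ \in _).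
rewrite !mul0n !addn0 -lez_nat -height_horizontal.
by apply: height_le_of_bounded; exact: set_mem.
Qed.

Lemma bounded_infinite_clusters_not_full (R : realType)
    (mu : probability config R) :
  stationary mu -> (0 < mean_h mu)%E ->
  mu (\bigcup_M bounded_infinite_clusters M) <> 1%E.
Proof.
move=> st h0 full.
have : mean_h mu \is a fin_num.
  rewrite -(stationary_label_event 0 st).
  by apply: fin_num_measure; exact: label_event_measurable.
move: h0 (fun M n => @height_tight _ _ M n st).
case: (mean_h mu) => [h| |]// h0 tight _; rewrite lte_fin in h0.
(* The two exceptional events together then cost less than [h / 2] per step. *)
have [M HM] : exists M, ((1 - h / 4)%:E < mu (bounded_infinite_clusters M))%E.
  apply: contrapT => /forallNP nM.
  have : (1 <= (1 - h / 4)%:E :> \bar R)%E.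
    rewrite -full.
    (* Continuity from below along the increasing events. *)
    have cv : mu \o bounded_infinite_clusters @ \oo -->
        mu (\bigcup_M bounded_infinite_clusters M).
      apply: nondecreasing_cvg_mu => [M||M N MN].
      - exact: bounded_infinite_clusters_measurable.
      - apply: bigcupT_measurable => M.
        exact: bounded_infinite_clusters_measurable.
      - exact/subsetPset/bounded_infinite_clusters_le.
    apply: (cvge_to_le cv); apply: nearW => M /=.
    by rewrite leNgt; apply/negP/nM.
  rewrite lee_fin; lra.
have mM := bounded_infinite_clusters_measurable M.
have : mu (~` bounded_infinite_clusters M) \is a fin_num.
  by apply: fin_num_measure; exact: measurableC.
have : (mu (~` bounded_infinite_clusters M) < (h / 4)%:E)%E.
  rewrite probability_setC//.
  have : mu (bounded_infinite_clusters M) \is a fin_num.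
    exact: fin_num_measure.
  move: HM; case: (mu _) => //= r; rewrite lte_fin => rh _.
  rewrite (_ : (1 - r%:E)%E = (1 - r)%:E)// lte_fin; lra.
move: (tight M); case: (mu _) => // q {}tight; rewrite lte_fin => qh _.
(* This [n] makes [2M] less than [n * h / 4], so the bound would give [n * h < 3 / 4 * (n * h)]. *)
pose n := (Num.truncn (4 * (M + M)%N%:R / h)).+1.
have hn : 4 * (M + M)%N%:R / h < n%:R by exact: Num.Theory.truncnS_gt.
have := tight n.
have -> : (n%:R%:E * h%:E <= (M + M)%N%:R%:E + n%:R%:E * (q%:E + q%:E))%E
    = (n%:R * h <= (M + M)%N%:R + n%:R * (q + q)) by rewrite -lee_fin.
move: hn; rewrite ltr_pdivrMr// => hn.
have n0 : 0 < n%:R :> R by rewrite ltr0n.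
have : n%:R * q < n%:R * (h / 4) by rewrite ltr_pM2l.
have : 0 <= (M + M)%N%:R :> R by [].
move: (n%:R : R) ((M + M)%N%:R : R) hn n0 => x y; nra.
Qed.

(** * Conclusion by ergodicity *)

Lemma probability1_negligible (R : realType) (mu : probability config R)
    (A : set config) : measurable A -> mu A = 1%E -> mu.-negligible (~` A).
Proof.
move=> mA A1; apply: (negligibleP mu (measurableC mA)).2.
change (mu (~` A) = 0%E).
by rewrite probability_setC// A1 subee.
Qed.

Theorem lemma3p2 (R : realType) (mu : probability config R) :
  cocycle_measure mu -> stationary mu -> ergodic mu ->
  (0 < mean_h mu < 1)%E -> (0 < mean_v mu < 1)%E ->
  (0 < mu [set w | infinite_clusters w !=set0])%E ->
  {ae mu, forall w, infinite_set (infinite_clusters w)}.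
Proof.
move=> coc st erg /andP[h0 _] _ I0.
have mI := exists_infinite_cluster_measurable.
have mF := finitely_many_infinite_clusters_measurable.
have I1 : mu exists_infinite_cluster = 1%E.
  have [I0'|//] := erg _ mI (translate_invariant exists_infinite_cluster_translate).
  suff E : [set w | infinite_clusters w !=set0] = exists_infinite_cluster.
    by move: I0; rewrite E I0' ltxx.
  apply/seteqP; split => w /=.
    by case=> C [IC [z E]]; exists z; rewrite -E.
  by case=> z Iz; exists (cluster w z); split => //; exists z.
(* By ergodicity, having finitely many infinite clusters has probability 0, which is the claim, or
   1, which is refuted below. *)
have [F0|F1] :=
    erg _ mF (translate_invariant finitely_many_infinite_clusters_translate).
  apply: (negligibleS _ ((negligibleP mu mF).2 F0)) => w /=.
  by move=> /contrapT; exact: finite_infinite_clusters.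
have mU : measurable (\bigcup_M bounded_infinite_clusters M).
  by apply: bigcupT_measurable => M; exact: bounded_infinite_clusters_measurable.
case: (bounded_infinite_clusters_not_full st h0).
(* Almost surely the cocycle property, existence and finiteness hold together, and then some bound
   [M] works. *)
have nU : mu.-negligible (~` \bigcup_M bounded_infinite_clusters M).
  have := negligibleU coc (negligibleU (probability1_negligible mI I1)
    (probability1_negligible mF F1)).
  apply: negligibleS => w; rewrite -!setCI; apply: contra_not => -[cw [Iw Fw]].
  have [M HM] := bounded_infinite_clusters_cover (cocycle_square_law cw) Iw Fw.
  by exists M.
have U0 : mu (~` \bigcup_M bounded_infinite_clusters M) = 0%E.
  exact: (measure_negligible (measurableC mU) nU).
by rewrite -[X in mu X]setCK probability_setC ?U0 ?sube0//; exact: measurableC.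
Qed.
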